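(* Assume (A)–(F) (see context). If the constraints of (P) satisfy the local LICQ, i.e. there exists $\zeta>0$ such that $\sigma_{\min}\big([\nabla g_{J_g(x^* )}(x^* ),\,A_{J_A(x^* )}^\top]\big)\ge\zeta$ for every $x^*\in\mathcal X^*$, then the local error bound condition (EBC) holds: there exist $\delta>0$, $\gamma>0$ and $d\in[1,2]$ such that, for every $x^*\in\mathcal X^*$, every $x\in\mathbb B(x^*,\delta)$, and all $I_g\subseteq J_g(x^* )$, $I_A\subseteq J_A(x^* )$, $$\mathrm{dist}(x,\mathcal S(I_g,I_A))^{2d}\le\gamma\Big(\sum_{i\in I_g}|g_i(x)|^2+\sum_{i\in[m]\setminus I_g}([g_i(x)]_+)^2+\sum_{j\in I_A}|[Ax-b]_j|^2+\sum_{j\in[l]\setminus I_A}([[Ax-b]_j]_+)^2\Big).$$ The converse does not hold: there is an instance of (P) satisfying (A)–(F) and the EBC that does not satisfy the local LICQ.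
   Context: **Problem.** $\mathcal X=\{x\in\mathbb R^n: Ax\le b\}$ with $A\in\mathbb R^{l\times n}$, $b\in\mathbb R^l$; $f,g_1,\dots,g_m:\mathbb R^n\to\mathbb R$ are differentiable, $g=(g_1,\dots,g_m)^\top$, $\nabla g(x)=[\nabla g_1(x),\dots,\nabla g_m(x)]\in\mathbb R^{n\times m}$. Problem (P): minimize $f(x)$ over $x\in\mathcal X$ subject to $g_i(x)\le0$, $i\in[m]$. Here $[m]=\{1,\dots,m\}$, $[l]=\{1,\dots,l\}$. $\|\cdot\|$ is the Euclidean norm (spectral norm for matrices), $[\cdot]_+=\max\{\cdot,0\}$, $\mathcal N_{\mathcal X}(x)$ is the normal cone of $\mathcal X$ at $x$, $\mathrm{dist}$ is Euclidean distance, $\mathbb B(x,\delta)$ the Euclidean ball. **Standing assumptions.** (A) $\mathcal X$ is compact with diameter $D_{\mathcal X}<\infty$. (B) $\min_{x\in\mathcal X}f(x)\ge\underline f$ for some $\underline f\in\mathbb R$. (C) $f$ and all $g_i$ are $L$-smooth (gradients $L$-Lipschitz on $\mathcal X$), and each $g_i$ is convex. (D) $\|\nabla f(x)\|\le B_f$ on $\mathcal X$. (E) $\max\{\|g(x)\|,\|\nabla g(x)\|\}\le B_g$ on $\mathcal X$. (F) There is $x_{\rm feas}\in\mathcal X$ with $g_i(x_{\rm feas})<0$ for all $i\in[m]$. **KKT points.** $\mathcal X^*$ is the set of $x\in\mathcal X$ with $g(x)\le0$ for which there is $\lambda\ge0$ in $\mathbb R^m$ with $-\nabla f(x)-\sum_i\lambda_i\nabla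 g_i(x)\in\mathcal N_{\mathcal X}(x)$ and $\lambda_ig_i(x)=0$ for all $i$. **Active sets.** $J_g(x)=\{i\in[m]: g_i(x)=0\}$, $J_A(x)=\{j\in[l]:[Ax-b]_j=0\}$. For $I_g\subseteq[m]$, $I_A\subseteq[l]$: $\mathcal S(I_g,I_A)=\{u\in\mathcal X: g_i(u)=0\ (i\in I_g),\ g_i(u)\le0\ (i\in[m]\setminus I_g),\ [Au-b]_j=0\ (j\in I_A),\ [Au-b]_j\le0\ (j\in[l]\setminus I_A)\}$. **Notation.** $\nabla g_{I}(x)$ is the matrix with columns $\nabla g_i(x)$, $i\in I$; $A_{I}$ is the submatrix of $A$ with rows indexed by $I$. $\sigma_{\min}(M)=\min_{\|w\|=1}\|Mw\|$ is the smallest singular value of $M$ (so $\sigma_{\min}(M)>0$ iff the columns of $M$ are linearly independent); for a matrix with no columns the condition is regarded as vacuously satisfied. *)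

(* Defs.v *)
From HB Require Import structures.
From mathcomp Require Import all_boot all_order all_algebra.
From mathcomp Require Import all_classical all_reals all_analysis.

Set Implicit Arguments.
Unset Strict Implicit.
Unset Printing Implicit Defensive.

Import Order.TTheory GRing.Theory Num.Theory.
Import numFieldNormedType.Exports.

Local Open Scope classical_set_scope.
Local Open Scope ring_scope.

Section EuclideanSpace.
Variable R : realType.

Definition dot n (u v : 'cV[R]_n) : R := \sum_i u i 0 * v i 0.

(* The library norm on matrices is the max norm, hence a separate Euclidean
   norm.  Both induce the same topology, so compactness and differentiability
   below are the library notions. *)
Definition enorm n (v : 'cV[R]_n) : R := Num.sqrt (\sum_i v i 0 ^+ 2).

Definition eball n (x : 'cV[R]_n) (r : R) : set 'cV[R]_n :=
  [set y | enorm (y - x) <= r].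

(* Meaningful for nonempty S only: [inf set0] is 0. *)
Definition dist n (x : 'cV[R]_n) (S : set 'cV[R]_n) : R :=
  inf [set enorm (x - u) | u in S].

Definition spectral_norm r c (M : 'M[R]_(r, c)) : R :=
  sup [set enorm (M *m w) | w in [set w : 'cV[R]_c | enorm w <= 1]].

(* Meaningful for c > 0 only: the unit sphere is empty when c = 0. *)
Definition sigma_min r c (M : 'M[R]_(r, c)) : R :=
  inf [set enorm (M *m w) | w in [set w : 'cV[R]_c | enorm w = 1]].

Definition grad n (h : 'cV[R]_n -> R) (x : 'cV[R]_n) : 'cV[R]_n :=
  \col_k 'D_(delta_mx k 0) h x.

Definition normal_cone n (X : set 'cV[R]_n) (x : 'cV[R]_n) : set 'cV[R]_n :=
  [set v | forall y, X y -> dot v (y - x) <= 0].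

Definition lipschitz_grad_on n (X : set 'cV[R]_n) (L : R)
    (h : 'cV[R]_n -> R) : Prop :=
  forall x y, X x -> X y -> enorm (grad h x - grad h y) <= L * enorm (x - y).

End EuclideanSpace.

Record problem (R : realType) (n m l : nat) := Problem {
  lhs : 'M[R]_(l, n);
  rhs : 'cV[R]_l;
  obj : 'cV[R]_n -> R;
  con : 'I_m -> 'cV[R]_n -> R;
  obj_differentiable : forall x, differentiable obj x;
  con_differentiable : forall i x, differentiable (con i) x
}.

Section Problem.
Variables (R : realType) (n m l : nat) (P : problem R n m l).

Definition lin_res (x : 'cV[R]_n) (j : 'I_l) : R := (lhs P *m x - rhs P) j 0.

Definition polyhedron : set 'cV[R]_n := [set x | forall j, lin_res x j <= 0].

Definition con_vec (x : 'cV[R]_n) : 'cV[R]_m := \col_i con P i x.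

Definition grad_con (x : 'cV[R]_n) : 'M[R]_(n, m) :=
  \matrix_(k, i) grad (con P i) x k 0.

Record standing_assumptions : Prop := StandingAssumptions {
  polyhedron_compact : compact polyhedron;
  polyhedron_diameter : exists D : R,
    forall x y, polyhedron x -> polyhedron y -> enorm (x - y) <= D;
  obj_bounded_below : exists f0 : R, forall x, polyhedron x -> f0 <= obj P x;
  smoothness : exists L : R, lipschitz_grad_on polyhedron L (obj P) /\
    forall i, lipschitz_grad_on polyhedron L (con P i);
  con_convex : forall i, convex_function [set: 'cV[R]_n] (con P i);
  grad_obj_bounded : exists Bf : R,
    forall x, polyhedron x -> enorm (grad (obj P) x) <= Bf;
  con_bounded : exists Bg : R, forall x, polyhedron x ->
    Num.max (enorm (con_vec x)) (spectral_norm (grad_con x)) <= Bg;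
  slater : exists x, polyhedron x /\ forall i, con P i x < 0
}.

Definition kkt_points : set 'cV[R]_n :=
  [set x | [/\ polyhedron x, (forall i, con P i x <= 0) &
    exists lam : 'cV[R]_m,
      [/\ (forall i, 0 <= lam i 0),
          normal_cone polyhedron x
            (- grad (obj P) x - \sum_i lam i 0 *: grad (con P i) x) &
          forall i, lam i 0 * con P i x = 0]]].

Definition active_con (x : 'cV[R]_n) : {set 'I_m} :=
  [set i | con P i x == 0]%SET.

Definition active_lin (x : 'cV[R]_n) : {set 'I_l} :=
  [set j | lin_res x j == 0]%SET.

Definition active_matrix (x : 'cV[R]_n) :
    'M[R]_(n, #|active_con x| + #|active_lin x|) :=
  row_mx (colsub (@enum_val _ (mem (active_con x))) (grad_con x))
         (rowsub (@enum_val _ (mem (active_lin x))) (lhs P))^T.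

Definition local_LICQ : Prop :=
  exists zeta : R, 0 < zeta /\
    forall x, kkt_points x -> (0 < #|active_con x| + #|active_lin x|)%N ->
      zeta <= sigma_min (active_matrix x).

Definition active_face (Ig : {set 'I_m}) (IA : {set 'I_l}) : set 'cV[R]_n :=
  [set u | polyhedron u /\
    [/\ (forall i, i \in Ig -> con P i u = 0),
        (forall i, i \notin Ig -> con P i u <= 0),
        (forall j, j \in IA -> lin_res u j = 0) &
        (forall j, j \notin IA -> lin_res u j <= 0)]].

Definition sq_residual (Ig : {set 'I_m}) (IA : {set 'I_l})
    (x : 'cV[R]_n) : R :=
  \sum_(i in Ig) `|con P i x| ^+ 2
  + \sum_(i | i \notin Ig) Num.max (con P i x) 0 ^+ 2
  + \sum_(j in IA) `|lin_res x j| ^+ 2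
  + \sum_(j | j \notin IA) Num.max (lin_res x j) 0 ^+ 2.

(* The faces below contain xstar, so [dist] is taken to nonempty sets. *)
Definition local_EBC : Prop :=
  exists delta gamma d : R, [/\ 0 < delta, 0 < gamma, 1 <= d <= 2 &
    forall xstar x, kkt_points xstar -> eball xstar delta x ->
    forall (Ig : {set 'I_m}) (IA : {set 'I_l}),
      Ig \subset active_con xstar -> IA \subset active_lin xstar ->
      dist x (active_face Ig IA) `^ (2 * d) <= gamma * sq_residual Ig IA x].

End Problem.

(* Main.v *)
Require Import Defs.
From HB Require Import structures.
From mathcomp Require Import all_boot all_order all_algebra.
From mathcomp Require Import all_classical all_reals all_analysis.
From mathcomp Require Import ring lra.

(** The error bound holds with [d = 1].

    Around one KKT point [x0], linear independence of the active gradients makes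
    the system of active constraints locally solvable with a linear estimate
    ([local_solvability]): every [x] near [x0] can be moved, by a displacement
    proportional to the residual, to a point [u] where the selected active
    constraints vanish and the other active ones are nonpositive.  Constraints
    inactive at [x0] remain negative at [u], so [u] lies in the face and
    [dist x S] is at most a multiple of the square root of the residual
    ([local_error_bound]).  The solvability theorem is a contraction argument
    along the span of the active gradients; it needs strict differentiability of
    the constraints at [x0], and a convex function that is differentiable at a
    point is strictly differentiable there ([convex_strict_gradient]).  So the
    point [x], which need not be in the polyhedron, causes no difficulty although
    gradients are Lipschitz on the polyhedron only.

    These constants depend on [x0], in particular on how negative the inactive
    constraints are, and this need not be uniform: the value of an inactive
    constraint may tend to zero along a sequence of KKT points.  Uniformity comes
    from compactness.  A bound around [x0] serves all nearby KKT points, since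
    their active sets are contained in that of [x0]; and the set of KKT points is
    compact ([kkt_points_compact]), being the projection of the set of pairs of a
    KKT point and a multiplier.  That set is closed because gradients are continuous
    on the polyhedron, and bounded because the Slater point bounds the
    multipliers ([multiplier_bound]).

    The converse fails for [x <= 0] and [- x <= 0] on the line: both rows are
    active at the only feasible point [0], hence dependent, while the distance to
    [0] is exactly the violation of one of the rows. *)

Set Implicit Arguments.
Unset Strict Implicit.
Unset Printing Implicit Defensive.

Import Order.TTheory GRing.Theory Num.Theory.
Import numFieldNormedType.Exports.

Local Open Scope classical_set_scope.
Local Open Scope ring_scope.

(** * Norms, inner product, distance *)

Section Norms.
Variable R : realType.

Lemma mx_norm_leP m n (M : 'M[R]_(m, n)) (c : R) : 0 <= c ->
  reflect (forall i j, `|M i j| <= c) (`|M| <= c).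
Proof.
move=> c0; rewrite [`|M|]/Num.norm /= mx_normrE; apply: (iffP idP).
  by move=> /bigmax_leP[_ h] i j; exact: (h (i, j)).
by move=> h; apply/bigmax_leP; split => // -[i j] _; exact: h.
Qed.

Lemma entry_le_norm m n (M : 'M[R]_(m, n)) i j : `|M i j| <= `|M|.
Proof. exact/mx_norm_leP. Qed.

Lemma norm_mulmx_le m n p (M : 'M[R]_(m, n)) (N : 'M[R]_(n, p)) :
  `|M *m N| <= n%:R * `|M| * `|N|.
Proof.
apply/mx_norm_leP => [|i j]; first by rewrite !mulr_ge0.
rewrite mxE (le_trans (ler_norm_sum _ _ _))//.
apply: (@le_trans _ _ (\sum_(k < n) `|M| * `|N|)).
  by apply: ler_sum => k _; rewrite normrM ler_pM// entry_le_norm.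
by rewrite sumr_const card_ord -mulrA mulr_natl.
Qed.

(** Topology and completeness come with the max norm [`| v |], while distances
    and Lipschitz constants are Euclidean; this lemma and the next translate
    between the two at the cost of a dimension factor. *)
Lemma norm_le_enorm n (v : 'cV[R]_n) : `|v| <= enorm v.
Proof.
apply/mx_norm_leP => [|i j]; first exact: sqrtr_ge0.
rewrite (ord1 j) -sqrtr_sqr ler_wsqrtr// (bigD1 i)//= lerDl.
by apply: sumr_ge0 => k _; exact: sqr_ge0.
Qed.

Lemma enorm_le_norm n (v : 'cV[R]_n) : enorm v <= n%:R * `|v|.
Proof.
rewrite -[leRHS]ger0_norm ?mulr_ge0// -sqrtr_sqr ler_wsqrtr//.
apply: (@le_trans _ _ (\sum_(k < n) `|v| ^+ 2)).
  apply: ler_sum => k _; rewrite -real_normK ?num_real//.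
  by rewrite lerXn2r ?nnegrE ?entry_le_norm.
rewrite sumr_const card_ord exprMn -[leLHS]mulr_natl ler_wpM2r ?sqr_ge0//.
by rewrite -natrX ler_nat; case: n v => // n v; rewrite expnS expn1 leq_pmulr.
Qed.

Lemma norm_dot_le n (u v : 'cV[R]_n) : `|dot u v| <= n%:R * `|u| * `|v|.
Proof.
suff -> : dot u v = (u^T *m v) 0 0.
  apply: le_trans (entry_le_norm _ _ _) (le_trans (norm_mulmx_le _ _) _).
  rewrite ler_wpM2r// ler_wpM2l//; apply/mx_norm_leP => // i j.
  by rewrite mxE entry_le_norm.
by rewrite mxE; apply: eq_bigr => k _; rewrite mxE.
Qed.

Lemma dotDr n (u v w : 'cV[R]_n) : dot u (v + w) = dot u v + dot u w.
Proof. by rewrite /dot -big_split; apply: eq_bigr => k _; rewrite mxE mulrDr. Qed.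

Lemma dotDl n (u v w : 'cV[R]_n) : dot (u + v) w = dot u w + dot v w.
Proof. by rewrite /dot -big_split; apply: eq_bigr => k _; rewrite mxE mulrDl. Qed.

Lemma dotZr n a (u v : 'cV[R]_n) : dot u (a *: v) = a * dot u v.
Proof. by rewrite /dot mulr_sumr; apply: eq_bigr => k _; rewrite mxE mulrCA. Qed.

Lemma dotZl n a (u v : 'cV[R]_n) : dot (a *: u) v = a * dot u v.
Proof. by rewrite /dot mulr_sumr; apply: eq_bigr => k _; rewrite mxE mulrA. Qed.

Lemma dotNr n (u v : 'cV[R]_n) : dot u (- v) = - dot u v.
Proof. by rewrite -scaleN1r dotZr mulN1r. Qed.

Lemma dotNl n (u v : 'cV[R]_n) : dot (- u) v = - dot u v.
Proof. by rewrite -scaleN1r dotZl mulN1r. Qed.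

Lemma dot_suml n (I : finType) (u : I -> 'cV[R]_n) v :
  dot (\sum_i u i) v = \sum_i dot (u i) v.
Proof.
rewrite /dot exchange_big; apply: eq_bigr => k _ /=.
by rewrite summxE mulr_suml.
Qed.

End Norms.

Section EuclideanFacts.
Variable R : realType.

Lemma enorm_ge0 n (v : 'cV[R]_n) : 0 <= enorm v.
Proof. exact: sqrtr_ge0. Qed.

Lemma enormZ n (a : R) (v : 'cV[R]_n) : enorm (a *: v) = `|a| * enorm v.
Proof.
rewrite /enorm -sqrtr_sqr -sqrtrM ?sqr_ge0// mulr_sumr; congr Num.sqrt.
by apply: eq_bigr => k _; rewrite mxE exprMn.
Qed.

(** The hypothesis on [sigma_min] is guarded by [0 < c] because without columns
    the unit sphere is empty; the kernel is then trivial anyway.  Otherwise a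
    normalized kernel vector would put [0] in the set whose infimum is
    [sigma_min M]. *)
Lemma sigma_min_injective n c (M : 'M[R]_(n, c)) (zeta : R) : 0 < zeta ->
  ((0 < c)%N -> zeta <= sigma_min M) -> forall w : 'cV_c, M *m w = 0 -> w = 0.
Proof.
move=> zeta0 hM w Mw; apply/eqP; apply: contraT => w0.
have c0 : (0 < c)%N by case: c M hM w Mw w0 => // M _ w _; rewrite flatmx0 eqxx.
have nw : 0 < enorm w.
  by apply: lt_le_trans (norm_le_enorm w); rewrite normr_gt0.
suff s0 : sigma_min M <= 0.
  by have := lt_le_trans zeta0 (le_trans (hM c0) s0); rewrite ltxx.
apply: ge_inf; first by exists 0 => _ [v _ <-]; exact: enorm_ge0.
exists ((enorm w)^-1 *: w) => /=.
  by rewrite enormZ gtr0_norm ?invr_gt0// mulVf ?gt_eqF.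
by rewrite -scalemxAr Mw scaler0 -(scale0r 0) enormZ normr0 mul0r.
Qed.

Lemma dist_ge0 n (x : 'cV[R]_n) S : 0 <= dist x S.
Proof.
have [->|/set0P[u Su]] := eqVneq S set0; first by rewrite /dist image_set0 inf0.
apply: lb_le_inf; first by exists (enorm (x - u)); exists u.
by move=> _ [v _ <-]; exact: enorm_ge0.
Qed.

Lemma dist_le n (x u : 'cV[R]_n) (S : set 'cV[R]_n) :
  S u -> dist x S <= enorm (x - u).
Proof.
move=> Su; apply: ge_inf; last by exists u.
by exists 0 => _ [v _ <-]; exact: enorm_ge0.
Qed.

Lemma dot_continuous n (a : 'cV[R]_n) : continuous (dot a).
Proof.
apply: continuous_big => [|k _ v]; first exact: add_continuous.
apply: (continuous_comp (f := fun w : 'cV[R]_n => w k 0)).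
  exact: coord_continuous.
exact: mulrl_continuous.
Qed.

End EuclideanFacts.

Lemma near_norm_ball (R : realType) (V : normedModType R) (x : V) (P : set V) :
  (\forall y \near x, P y) ->
  exists2 r : R, 0 < r & forall y, `|y - x| < r -> P y.
Proof.
move=> /nbhs_normP[r /= r0 Pr]; exists r => // y yx.
by apply: Pr; rewrite /ball_ /= distrC.
Qed.

Lemma closure_le0 (R : realType) (T : topologicalType) (A : set T)
    (psi : T -> R) p :
  continuous psi -> (forall q, A q -> psi q <= 0) -> closure A p -> psi p <= 0.
Proof.
move=> psi_cont psi_le.
have cl : closed (psi @^-1` [set r : R | r <= 0]).
  by apply: preimage_closed (@closed_le _ 0) => q _; exact: psi_cont.
move=> /(closureS (psi_le : A `<=` psi @^-1` [set r : R | r <= 0])).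
by rewrite -((closure_id _).1 cl).
Qed.

(** * Strict differentiability of convex functions *)

Section Calculus.
Variables (R : realType) (n : nat).
Implicit Types (h : 'cV[R]_n -> R) (x y : 'cV[R]_n).

Lemma diff_dot_grad h x v : differentiable h x -> 'd h x v = dot (grad h x) v.
Proof.
move=> hx; have -> : v = \sum_i v i 0 *: delta_mx i 0 :> 'cV[R]_n.
  apply/colP => i; rewrite summxE (bigD1 i)//= big1 => [|k ki].
    by rewrite !mxE !eqxx mulr1 addr0.
  by rewrite !mxE eq_sym (negbTE ki) mulr0.
rewrite linear_sum /dot; under [RHS]eq_bigr => k _.
  rewrite summxE (bigD1 k)//= big1 => [|j jk].
    rewrite !mxE !eqxx mulr1 addr0 deriveE//; over.
  by rewrite !mxE eq_sym (negbTE jk) mulr0.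
by apply: eq_bigr => k _; rewrite linearZ /= mulrC.
Qed.

Lemma first_order_expansion h x e : differentiable h x -> 0 < e ->
  \forall y \near x, `|h y - h x - dot (grad h x) (y - x)| <= e * `|y - x|.
Proof.
move=> hx e0; have /diff_locally/eqaddoP/(_ e e0) := hx.
rewrite near_simpl => H.
rewrite (near_shift 0 x) subr0; near=> y.
rewrite /= addrK -diff_dot_grad//.
have : `|(h \o shift x - (cst (h x) + 'd h x)) y| <= e * `|y| by near: y.
by rewrite !fctE /= opprD addrA.
Unshelve. all: by end_near. Qed.

Lemma convex_functionP h x y (t : R) : convex_function [set: 'cV[R]_n] h ->
  0 <= t <= 1 -> h (t *: x + (1 - t) *: y) <= t * h x + (1 - t) * h y.
Proof.
move=> hc t01; have [t0 t1] := andP t01.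
exact: hc (Itv01 t0 t1) x y (in_setT _) (in_setT _).
Qed.

End Calculus.

Section StrictDifferentiability.
Variables (R : realType) (n : nat).
Implicit Types (h : 'cV[R]_n -> R) (x y : 'cV[R]_n).

(** Convexity bounds [h] on a short initial piece of the segment from [x] to
    [y] by the chord, and the first order expansion bounds it below by the
    tangent up to an arbitrarily small slope; comparing slopes gives the
    inequality. *)
Lemma convex_above_tangent h x y : convex_function [set: 'cV[R]_n] h ->
  differentiable h x -> h x + dot (grad h x) (y - x) <= h y.
Proof.
move=> hc hx; rewrite addrC -lerBrDr; apply/ler_addgt0Pr => e e0.
set v := y - x; have v0 : 0 <= `|v| by [].
have e'0 : 0 < e / (`|v| + 1) by rewrite divr_gt0// ltr_wpDl.
have [r r0 hr] := near_norm_ball (first_order_expansion hx e'0).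
have rv0 : 0 < r + `|v| + 1 by lra.
(* this denominator gives both t <= 1 and t * |v| < r *)
pose t := r / (r + `|v| + 1).
have t0 : 0 < t by rewrite divr_gt0.
have t1 : t <= 1 by rewrite ler_pdivrMr//; lra.
have tv : t * `|v| < r by rewrite mulrAC ltr_pdivrMr//; nra.
have /hr : `|(x + t *: v) - x| < r by rewrite addrC addKr normrZ gtr0_norm.
rewrite [x + _]addrC addrK dotZr normrZ gtr0_norm// => /ler_normlP[+ _].
have : h (t *: v + x) <= t * h y + (1 - t) * h x.
  have -> : t *: v + x = t *: y + (1 - t) *: x.
    by rewrite /v scalerBr scalerBl scale1r addrA addrAC.
  by apply: convex_functionP => //; rewrite ltW.
move=> h1 h2.
have : t * dot (grad h x) v <= t * (h y - h x + e / (`|v| + 1) * `|v|) by nra.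
rewrite ler_pM2l// => /le_trans; apply; rewrite lerD2l.
rewrite mulrAC ler_pdivrMr; nra.
Qed.

(** Prolong the segment from [z] to [y] by the length [r] up to a point [w] that
    still lies in the large ball: the slope between [z] and [y] is at most the
    slope between [z] and [w], where [h] varies by at most [2 * eta] over a
    length at least [r]. *)
Lemma convex_bounded_lipschitz h x (r eta : R) : 0 < r ->
  (forall y z t, 0 <= t <= 1 ->
     h (t *: y + (1 - t) *: z) <= t * h y + (1 - t) * h z) ->
  (forall y, `|y - x| < 2 * r -> `|h y| <= eta) ->
  forall y z, `|y - x| < r -> `|z - x| < r ->
    `|h y - h z| <= 2 * eta / r * `|y - z|.
Proof.
move=> r0 hc hb.
suff one_sided y z : `|y - x| < r -> `|z - x| < r ->
    h y - h z <= 2 * eta / r * `|y - z|.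
  move=> y z yx zx; apply/ler_normlP; split; last exact: one_sided.
  by rewrite opprB distrC one_sided.
move=> yx zx; have [->|yz] := eqVneq y z; first by rewrite !subrr normr0 mulr0.
set d := `|y - z|; have d0 : 0 < d by rewrite normr_gt0 subr_eq0.
(* t is the weight of w when y is written as a convex combination of w and z *)
pose t := d / (d + r).
have dr0 : 0 < d + r by rewrite addr_gt0.
have t0 : 0 < t by rewrite divr_gt0.
have t1 : t <= 1 by rewrite ler_pdivrMr//; lra.
pose w := y + (r / d) *: (y - z).
have yE : y = t *: w + (1 - t) *: z.
  have -> : 1 - t = t * (r / d).
    by rewrite /t; field; rewrite !gt_eqF.
  rewrite -(scalerA t (r / d)) -scalerDr /w -addrA -scalerDr subrK.
  rewrite -[X in X + _]scale1r -scalerDl scalerA.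
  have -> : t * (1 + r / d) = 1 by rewrite /t; field; rewrite !gt_eqF.
  by rewrite scale1r.
have wx : `|w - x| < 2 * r.
  rewrite /w addrAC (le_lt_trans (ler_normD _ _))// normrZ -/d.
  by rewrite gtr0_norm ?divr_gt0// divfK ?gt_eqF//; lra.
have zx2 : `|z - x| < 2 * r by lra.
have := hc w z t; rewrite -yE (ltW t0) t1 => /(_ isT) h1.
have /ler_normlP[_ hw] := hb _ wx; have /ler_normlP[hz _] := hb _ zx2.
have eta0 : 0 <= eta by apply: le_trans (hb _ wx).
have : h y - h z <= t * (2 * eta) by nra.
move=> /le_trans; apply; rewrite mulrC -!mulrA ler_wpM2l//ler_wpM2l//.
by rewrite /t mulrC ler_wpM2r ?(ltW d0)// lef_pV2 ?posrE//; lra.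
Qed.

(** Strict (Leach) differentiability: the remainder of the expansion at
    [x] is Lipschitz with arbitrarily small constant near [x].  This is what
    makes the Newton-type map of [local_solvability] a contraction, and it does
    not ask for a gradient at points other than [x]. *)
Definition strict_gradient h x (a : 'cV[R]_n) : Prop :=
  forall e, 0 < e -> \forall yz \near (x, x),
    `|h yz.1 - h yz.2 - dot a (yz.1 - yz.2)| <= e * `|yz.1 - yz.2|.

(** The remainder [rem] of the first order expansion is convex, since it
    differs from [h] by an affine function, and is bounded by [e / 4 * r] on
    the ball of radius [r].  A convex function bounded by [eta] on a ball of
    radius [2 * s] is [2 * eta / s]-Lipschitz on the concentric ball of radius
    [s]; with [s = r / 2] this constant is [e]. *)
Lemma convex_strict_gradient h x : convex_function [set: 'cV[R]_n] h ->
  differentiable h x -> strict_gradient h x (grad h x).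
Proof.
move=> hc hx e e0; have e4 : 0 < e / 4 by rewrite divr_gt0.
have [r r0 hr] := near_norm_ball (first_order_expansion hx e4).
pose rem y := h y - h x - dot (grad h x) (y - x).
pose s := r / 2; have s0 : 0 < s by rewrite divr_gt0.
have rem_lip := @convex_bounded_lipschitz rem x s (e / 4 * r) s0.
have {}rem_lip y z : `|y - x| < s -> `|z - x| < s ->
    `|rem y - rem z| <= e * `|y - z|.
  have -> : e = 2 * (e / 4 * r) / s by rewrite /s; field; rewrite gt_eqF.
  apply: rem_lip => [{}y {}z t t01|{}y].
    have -> : rem (t *: y + (1 - t) *: z) = h (t *: y + (1 - t) *: z) - h x
        - (t * dot (grad h x) (y - x) + (1 - t) * dot (grad h x) (z - x)).
      rewrite /rem -!dotZr -dotDr !scalerBr addrACA -opprD -scalerDl.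
      by rewrite [t + _]addrC subrK scale1r.
    by have := convex_functionP y z hc t01; rewrite /rem; nra.
  rewrite /s mulrC divfK// => yx; apply: le_trans (hr _ yx) _.
  by rewrite ler_wpM2l ?ltW.
have sx : \forall y \near x, `|y - x| < s.
  by apply/nbhs_normP; exists s => //= y; rewrite /ball_ /= distrC.
near=> yz.
have -> : h yz.1 - h yz.2 - dot (grad h x) (yz.1 - yz.2) = rem yz.1 - rem yz.2.
  rewrite /rem !dotDr !dotNr; ring.
apply: rem_lip; near: yz; first exact: (cvg_fst sx).
exact: (cvg_snd sx).
Unshelve. all: by end_near. Qed.

Lemma affine_strict_gradient h x (a : 'cV[R]_n) :
  (forall y z, h y - h z = dot a (y - z)) -> strict_gradient h x a.
Proof.
move=> ha e e0; apply: (@filterE _ (nbhs (x, x))) => yz.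
by rewrite ha subrr normr0 mulr_ge0// ltW.
Qed.

End StrictDifferentiability.

(** * Local solvability of systems with independent gradients *)

(** Joins completeness with the normed module structure of matrices, as the
    Banach fixed point theorem requires. *)
HB.instance Definition _ (R : realType) (m n : nat) :=
  Complete.copy 'M[R]_(m, n) 'M[R]_(m, n).

Section LocalSolvability.
Variable R : realType.

(** If [u] is in the left kernel of [M^T *m M] then [M *m u^T] has squared
    Euclidean norm [u *m (M^T *m M) *m u^T = 0]. *)
Lemma gram_unitmx n c (M : 'M[R]_(n, c)) :
  (forall w : 'cV_c, M *m w = 0 -> w = 0) -> M^T *m M \in unitmx.
Proof.
move=> inj; rewrite -row_free_unit; apply: inj_row_free => u uG.
apply: trmx_inj; rewrite trmx0; apply: inj; apply/colP => i; rewrite [RHS]mxE.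
have : \sum_k (M *m u^T) k 0 ^+ 2 = 0.
  transitivity ((u *m (M^T *m M) *m u^T) 0 0); last by rewrite uG mul0mx mxE.
  rewrite mulmxA -mulmxA -[u in u *m M^T]trmxK -trmx_mul mxE.
  by apply: eq_bigr => k _; rewrite [_^T _ _]mxE -expr2.
move=> /eqP; rewrite psumr_eq0 => [/allP/(_ i)|k _]; last exact: sqr_ge0.
by rewrite mem_index_enum sqrf_eq0 => /(_ isT)/eqP.
Qed.

(** A quantitative Lyusternik-Graves theorem.  The columns of [M] are the
    gradients of the components of [F] at [x0], so [F (x + M *m v)] varies with
    [v] like [G *m v] up to a small Lipschitz error, where [G := M^T *m M] is
    invertible.  Hence [v |-> v + G^-1 (t - F (x + M *m v))] is a contraction
    of a small ball, and its fixed point solves [F (x + M *m v) = t].  As [0] is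
    moved by [G^-1 (t - F x)], the fixed point has size [O(t - F x)]. *)
Lemma local_solvability n c (F : 'cV[R]_n -> 'cV[R]_c) (M : 'M[R]_(n, c)) x0 :
  (forall k, strict_gradient (fun x => F x k 0) x0 (col k M)) ->
  (forall w : 'cV_c, M *m w = 0 -> w = 0) ->
  exists C delta : R, [/\ 0 < C, 0 < delta & forall x t, `|x - x0| <= delta ->
    `|t - F x| <= delta -> exists2 u, F u = t & `|u - x| <= C * `|t - F x|].
Proof.
move=> dF /gram_unitmx Gu.
set G := M^T *m M in Gu; set H := invmx G.
pose K : R := c%:R * `|H| + 1; have K0 : 0 < K by rewrite ltr_wpDl// mulr_ge0.
have HK (w : 'cV_c) : `|H *m w| <= K * `|w|.
  apply: le_trans (norm_mulmx_le _ _) _; rewrite ler_wpM2r//; rewrite /K; lra.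
pose N : R := c%:R * `|M| + 1; have N0 : 0 < N by rewrite ltr_wpDl// mulr_ge0.
have MN (w : 'cV_c) : `|M *m w| <= N * `|w|.
  apply: le_trans (norm_mulmx_le _ _) _; rewrite ler_wpM2r//; rewrite /N; lra.
(* chosen so that the contraction constant K * e * N is 1 / 2 *)
pose e := (2 * K * N)^-1; have e0 : 0 < e by rewrite invr_gt0 !mulr_gt0.
have : \forall yz \near (x0, x0), forall k,
    `|F yz.1 k 0 - F yz.2 k 0 - dot (col k M) (yz.1 - yz.2)|
      <= e * `|yz.1 - yz.2|.
  by apply: (@filter_forall _ _ _ _ (nbhs_filter (x0, x0))) => k; exact: dF.
move=> /near_norm_ball[r r0 hr].
have {}hr y z : `|y - x0| < r -> `|z - x0| < r ->
    `|F y - F z - M^T *m (y - z)| <= e * `|y - z|.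
  move=> yr zr; apply/mx_norm_leP => [|k j].
    by rewrite mulr_ge0// ltW.
  have /= := hr (y, z) _ k; rewrite (ord1 j) !mxE /dot.
  under eq_bigr do rewrite mxE; under [in X in _ -> X]eq_bigr do rewrite mxE.
  by apply; rewrite /Num.norm /= gt_max yr zr.
(* with this rho and |x - x0| <= r / 4, every x + M v with |v| <= rho is in the
   ball of radius r around x0 *)
pose rho := r / (4 * N); have rho0 : 0 < rho by rewrite divr_gt0 ?mulr_gt0.
pose delta := Num.min (r / 4) (rho / (2 * K)).
exists (2 * K * N), delta; split; first by rewrite !mulr_gt0.
  by rewrite lt_min !divr_gt0 ?mulr_gt0.
move=> x t; rewrite !le_min => /andP[xr _] /andP[_ tr].
pose Phi v := v + H *m (t - F (x + M *m v)).
pose U := [set v : 'cV[R]_c | `|v| <= rho].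
have near_x v : U v -> `|x + M *m v - x0| < r.
  move=> Uv; rewrite addrAC (le_lt_trans (ler_normD _ _))//.
  have : N * `|v| <= r / 4.
    by apply: le_trans (ler_wpM2l (ltW N0) Uv) _; rewrite le_eqVlt /rho;
       apply/orP; left; apply/eqP; field; rewrite gt_eqF.
  by have := MN v; lra.
have PhiB v w : U v -> U w -> `|Phi v - Phi w| <= 2^-1 * `|v - w|.
  move=> Uv Uw; have -> : Phi v - Phi w =
      - (H *m (F (x + M *m v) - F (x + M *m w) - M^T *m (M *m (v - w)))).
    rewrite mulmxA -/G [H *m _]mulmxBr [H *m (G *m _)]mulmxA mulVmx// mul1mx.
    rewrite /Phi !mulmxBr !opprB !opprD !opprK.
    by apply/colP => i; rewrite !mxE; ring.
  have MvwE : M *m (v - w) = x + M *m v - (x + M *m w).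
    by rewrite mulmxBr opprD addrACA subrr add0r.
  rewrite normrN (le_trans (HK _))// MvwE.
  apply: le_trans (ler_wpM2l (ltW K0) (hr _ _ (near_x _ Uv) (near_x _ Uw))) _.
  rewrite -MvwE.
  apply: le_trans (ler_wpM2l (ltW K0) (ler_wpM2l (ltW e0) (MN _))) _.
  rewrite le_eqVlt /e; apply/orP; left; apply/eqP; field.
  by rewrite !gt_eqF.
have Phi0 : `|Phi 0| <= K * `|t - F x|.
  by rewrite /Phi mulmx0 addr0 add0r.
have U0 : U 0 by rewrite /U /= normr0 ltW.
have PhiU : set_fun U U Phi.
  move=> v Uv; rewrite /U /= -[Phi v](subrK (Phi 0)).
  apply: le_trans (ler_normD _ _) _.
  have := PhiB _ _ Uv U0; rewrite subr0.
  have : K * `|t - F x| <= rho / 2.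
    apply: le_trans (ler_wpM2l (ltW K0) tr) _.
    by rewrite le_eqVlt; apply/orP; left; apply/eqP; field; rewrite gt_eqF.
  by move: Uv; rewrite /U /=; lra.
have Phi_ctr : is_contraction (mkfun PhiU).
  exists (2^-1)%:nng; split; first by rewrite /= invf_lt1// ltr1n.
  by case=> v w [Uv Uw] /=; exact: PhiB.
have Ucl : closed U.
  by apply: preimage_closed (@closed_le _ rho) => v _; exact: norm_continuous.
have [p Up pE] := banach_fixed_point Phi_ctr Ucl (ex_intro _ 0 U0).
have Fp : F (x + M *m p) = t.
  apply/eqP; rewrite eq_sym -subr_eq0 -(mulKVmx Gu (t - _)) -/H.
  move: pE; rewrite /= /Phi -[LHS]addr0 => /addrI <-.
  by rewrite mulmx0.
exists (x + M *m p) => //; rewrite addrC addKr.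
apply: le_trans (MN _) _.
rewrite [leRHS](_ : _ = N * (2 * K * `|t - F x|)); last by ring.
rewrite ler_wpM2l ?(ltW N0)//.
have := PhiB _ _ Up U0; rewrite subr0 => pPhi.
have : `|Phi p| <= `|Phi p - Phi 0| + `|Phi 0|.
  by rewrite -{1}[Phi p](subrK (Phi 0)) ler_normD.
have -> : `|Phi p| = `|p| by rewrite [in RHS]pE.
lra.
Qed.

End LocalSolvability.

(** * The error bound near one feasible point *)

Section ErrorBound.
Variables (R : realType) (n m l : nat) (P : problem R n m l).
Implicit Types (s : 'I_m + 'I_l) (x u : 'cV[R]_n).

(** One index set for both kinds of constraints, because solvability of the
    active system and the residual treat them alike. *)
Definition constr s x : R :=
  match s with inl i => con P i x | inr j => lin_res P x j end.

Definition constr_grad s x : 'cV[R]_n :=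
  match s with inl i => grad (con P i) x | inr j => (row j (lhs P))^T end.

Definition selected (Ig : {set 'I_m}) (IA : {set 'I_l}) s : bool :=
  match s with inl i => i \in Ig | inr j => j \in IA end.

(** The constraint whose gradient is the [k]-th column of [active_matrix]. *)
Definition active_constr x (k : 'I_(#|active_con P x| + #|active_lin P x|)) :
    'I_m + 'I_l :=
  match fintype.split k with
  | inl a => inl (enum_val a)
  | inr b => inr (enum_val b)
  end.

Lemma lin_res_dot x j : lin_res P x j = dot (row j (lhs P))^T x - rhs P j 0.
Proof.
rewrite /lin_res !mxE; congr (_ - _).
by apply: eq_bigr => k _; rewrite !mxE.
Qed.

Lemma constr_continuous s : continuous (constr s).
Proof.
case: s => [i|j] x /=; first exact/differentiable_continuous/con_differentiable.
rewrite (_ : constr (inr j) = fun y => dot (row j (lhs P))^T y - rhs P j 0).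
  by apply: continuousB; [exact: dot_continuous|exact: cst_continuous].
by apply/funext => y; exact: lin_res_dot.
Qed.

Lemma constr_strict_gradient s x :
  (forall i, convex_function [set: 'cV[R]_n] (con P i)) ->
  strict_gradient (constr s) x (constr_grad s x).
Proof.
move=> Pconv; case: s => [i|j] /=.
  by apply: convex_strict_gradient (Pconv i) _; exact: con_differentiable.
apply: affine_strict_gradient => y z.
by rewrite /= !lin_res_dot dotDr dotNr; ring.
Qed.

Lemma active_constr0 x k : constr (@active_constr x k) x = 0.
Proof.
rewrite /active_constr; case: fintype.split => a /=.
  by have := enum_valP a; rewrite inE => /eqP.
by have := enum_valP a; rewrite inE => /eqP.
Qed.

Lemma active_constr_surj s x :
  constr s x = 0 -> exists k, @active_constr x k = s.
Proof.
rewrite /active_constr; case: s => [i|j] /= /eqP sx.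
  have iJ : i \in active_con P x by rewrite inE.
  exists (lshift _ (enum_rank_in iJ i)).
  by rewrite (unsplitK (inl _)) enum_rankK_in.
have jJ : j \in active_lin P x by rewrite inE.
exists (rshift _ (enum_rank_in jJ j)).
by rewrite (unsplitK (inr _)) enum_rankK_in.
Qed.

Lemma col_active_matrix x k :
  col k (active_matrix P x) = constr_grad (active_constr k) x.
Proof.
apply/colP => i; rewrite mxE /active_matrix /active_constr.
case: (split_ordP k) => a ->.
  by apply: etrans (row_mxEl _ _ _ _) _; rewrite !mxE.
by apply: etrans (row_mxEr _ _ _ _) _; rewrite !mxE.
Qed.

Lemma active_faceP (Ig : {set 'I_m}) (IA : {set 'I_l}) u :
  (forall s, constr s u <= 0) ->
  (forall s, selected Ig IA s -> constr s u = 0) -> active_face P Ig IA u.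
Proof.
move=> u_le u_eq; split; first by move=> j; exact: (u_le (inr j)).
split=> [i iI|i _|j jI|j _].
- exact: (u_eq (inl i)).
- exact: (u_le (inl i)).
- exact: (u_eq (inr j)).
- exact: (u_le (inr j)).
Qed.

Lemma active_face_center x (Ig : {set 'I_m}) (IA : {set 'I_l}) :
  polyhedron P x -> (forall i, con P i x <= 0) ->
  Ig \subset active_con P x -> IA \subset active_lin P x ->
  active_face P Ig IA x.
Proof.
move=> Xx gx /fintype.subsetP IgS /fintype.subsetP IAS.
apply: active_faceP => -[i|j] /=; [exact: gx|exact: Xx| |].
  by move=> /IgS; rewrite inE => /eqP.
by move=> /IAS; rewrite inE => /eqP.
Qed.

Definition violation (Ig : {set 'I_m}) (IA : {set 'I_l}) s x : R :=
  if selected Ig IA s then `|constr s x| else Num.max (constr s x) 0.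

Lemma sq_residual_violation (Ig : {set 'I_m}) (IA : {set 'I_l}) x :
  sq_residual P Ig IA x = \sum_s violation Ig IA s x ^+ 2.
Proof.
rewrite big_sumType /= /violation /=.
rewrite (bigID (mem Ig)) /= [X in _ + X](bigID (mem IA)) /=.
rewrite /sq_residual -addrA; congr (_ + _ + (_ + _)).
- by apply: eq_bigr => i ->.
- by apply: eq_bigr => i /negbTE ->.
- by apply: eq_bigr => i ->.
- by apply: eq_bigr => i /negbTE ->.
Qed.

Lemma violation_le_residual Ig IA s x :
  violation Ig IA s x <= Num.sqrt (sq_residual P Ig IA x).
Proof.
have v0 : 0 <= violation Ig IA s x.
  by rewrite /violation; case: ifP => // _; rewrite le_max lexx orbT.
rewrite -[leLHS]ger0_norm// -sqrtr_sqr ler_wsqrtr// sq_residual_violation.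
by rewrite (bigD1 s)//= lerDl sumr_ge0// => k _; exact: sqr_ge0.
Qed.

Lemma inactive_near x0 : \forall x \near x0, forall s,
  constr s x0 < 0 -> constr s x < 0.
Proof.
apply: (@filter_forall _ _ _ _ (nbhs_filter x0)) => s.
have [sx0|_] := ltP (constr s x0) 0; last exact: nearW.
have := @constr_continuous s x0; move/cvgr_lt => /(_ _ sx0).
by apply: filterS.
Qed.

(** The error bound around a single point, with exponent [d = 1].  Active
    constraints are moved from their values at [x] to the target [t], which is
    [0] on the selected ones and caps the others at [0]; each entry of [t - F x]
    is, up to sign, the violation of that constraint.  Solving [F u = t] near [x]
    gives a point of the face, since constraints inactive at [x0] stay negative
    at [u]. *)
Lemma local_error_bound x0 :
  (forall i, convex_function [set: 'cV[R]_n] (con P i)) ->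
  (forall s, constr s x0 <= 0) ->
  (forall w : 'cV_(_), active_matrix P x0 *m w = 0 -> w = 0) ->
  exists gamma : R, \forall x \near (x0 : 'cV[R]_n),
    forall (Ig : {set 'I_m}) (IA : {set 'I_l}),
    Ig \subset active_con P x0 -> IA \subset active_lin P x0 ->
    dist x (active_face P Ig IA) ^+ 2 <= gamma * sq_residual P Ig IA x.
Proof.
move=> Pconv x0_le inj.
pose F x := \col_k constr (@active_constr x0 k) x.
have dF k : strict_gradient (fun x => F x k 0) x0 (col k (active_matrix P x0)).
  rewrite col_active_matrix.
  rewrite (_ : (fun x => F x k 0) = constr (active_constr k)).
    exact: constr_strict_gradient.
  by apply/funext => x; rewrite mxE.
have [C [delta [C0 delta0 solve]]] := local_solvability dF inj.
have [eta eta0 inactive] := near_norm_ball (inactive_near x0).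
(* Violations below tol keep t in the range where F u = t is solvable, and
   C * tol <= eta / 3 keeps u where inactive constraints are negative. *)
pose tol := Num.min delta (eta / (3 * C)).
have tol0 : 0 < tol by rewrite lt_min delta0 divr_gt0// mulr_gt0.
exists ((n%:R * C) ^+ 2).
have Fsmall : \forall x \near x0, `|F x| <= tol.
  have : \forall x \near x0, forall k, `|constr (@active_constr x0 k) x| <= tol.
    apply: (@filter_forall _ _ _ _ (nbhs_filter x0)) => k.
    have : constr (active_constr k) x @[x --> x0] --> (0 : R).
      by rewrite -(active_constr0 k); exact: constr_continuous.
    by move=> /cvgr0_norm_le; exact.
  apply: filterS => x hx; apply/mx_norm_leP => [|k j]; first exact: ltW.
  by rewrite mxE.
have xsmall : \forall x \near x0, `|x - x0| <= Num.min delta (eta / 3).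
  have d0 : 0 < Num.min delta (eta / 3) by rewrite lt_min delta0 divr_gt0.
  apply/nbhs_normP; exists (Num.min delta (eta / 3)) => //= y.
  by rewrite /ball_ /= distrC => /ltW.
near=> x => Ig IA IgS IAS.
have sel_active s : selected Ig IA s -> constr s x0 = 0.
  case: s => [i /(fintype.subsetP IgS)|j /(fintype.subsetP IAS)] /=;
  by rewrite inE => /eqP.
pose t : 'cV[R]_(#|active_con P x0| + #|active_lin P x0|) :=
  \col_k if selected Ig IA (active_constr k) then 0
         else Num.min (constr (active_constr k) x) 0.
have tF k : `|(t - F x) k 0| = violation Ig IA (active_constr k) x.
  rewrite !mxE /violation; case: ifP => _; first by rewrite sub0r normrN.
  set a := constr _ _; have [a0|a0] := leP a 0.
    by rewrite subrr normr0.
  by rewrite sub0r normrN gtr0_norm.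
have tF_res : `|t - F x| <= Num.sqrt (sq_residual P Ig IA x).
  apply/mx_norm_leP => [|k j]; first exact: sqrtr_ge0.
  by rewrite (ord1 j) tF violation_le_residual.
have tF_tol : `|t - F x| <= tol.
  apply: le_trans (_ : `|F x| <= tol); last by near: x.
  apply/mx_norm_leP => // k j; rewrite (ord1 j) tF.
  apply: le_trans (entry_le_norm (F x) k 0).
  rewrite mxE /violation; case: ifP => // _.
  by rewrite ge_max normr_ge0 ler_norm.
have : `|x - x0| <= Num.min delta (eta / 3) by near: x.
rewrite le_min => /andP[xdelta xeta].
have tF_delta : `|t - F x| <= delta.
  by apply: le_trans tF_tol _; rewrite ge_min lexx.
have [u Fu ux] := solve x t xdelta tF_delta.
have ueta : `|u - x0| < eta.
  have -> : u - x0 = (u - x) + (x - x0) by rewrite addrA subrK.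
  apply: le_lt_trans (ler_normD _ _) _.
  have : C * `|t - F x| <= eta / 3.
    have -> : eta / 3 = C * (eta / (3 * C)) by field; rewrite gt_eqF.
    rewrite ler_wpM2l ?(ltW C0)//; apply: le_trans tF_tol _.
    by rewrite ge_min lexx orbT.
  lra.
have face_u : active_face P Ig IA u.
  have uk k : constr (active_constr k) u = t k 0 by rewrite -Fu mxE.
  apply: active_faceP => s.
    have := x0_le s; rewrite le_eqVlt => /orP[/eqP sx0|/(inactive _ ueta)/ltW//].
    have [k <-] := active_constr_surj sx0; rewrite uk mxE.
    by case: ifP => // _; rewrite ge_min lexx orbT.
  move=> sI; have [k sk] := active_constr_surj (sel_active s sI).
  by rewrite -sk uk mxE sk sI.
have res0 : 0 <= sq_residual P Ig IA x.
  by rewrite sq_residual_violation sumr_ge0// => k _; exact: sqr_ge0.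
rewrite -[in leRHS](sqr_sqrtr res0) -exprMn.
rewrite lerXn2r ?nnegrE ?dist_ge0 ?mulr_ge0 ?sqrtr_ge0 ?(ltW C0)//.
apply: le_trans (dist_le x face_u) _.
apply: le_trans (enorm_le_norm _) _.
rewrite -mulrA ler_wpM2l// distrC (le_trans ux)// ler_wpM2l// ltW.
Unshelve. all: by end_near. Qed.

End ErrorBound.

(** * Compactness of the set of KKT points and the uniform error bound *)

Section MainImplication.
Variables (R : realType) (n m l : nat) (P : problem R n m l).

(** The Slater point bounds the multipliers: testing the normal cone condition
    at [xf] and using [dot (grad g_i x) (xf - x) <= g_i xf - g_i x], together
    with complementarity, bounds [- \sum_i lam_i * g_i xf] by
    [dot (grad f x) (xf - x)], and all terms of the sum are nonnegative. *)
Lemma multiplier_bound x xf (lam : 'cV[R]_m) :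
  (forall i, convex_function [set: 'cV[R]_n] (con P i)) ->
  polyhedron P xf -> (forall i, con P i xf <= 0) -> (forall i, 0 <= lam i 0) ->
  normal_cone (polyhedron P) x
    (- grad (obj P) x - \sum_i lam i 0 *: grad (con P i) x) ->
  (forall i, lam i 0 * con P i x = 0) ->
  forall i, lam i 0 * - con P i xf <= dot (grad (obj P) x) (xf - x).
Proof.
move=> Pconv Xxf xf_le lam0 /(_ _ Xxf) normal compl i.
move: normal; rewrite dotDl !dotNl dot_suml => normal.
have : \sum_j dot (lam j 0 *: grad (con P j) x) (xf - x)
    <= \sum_j lam j 0 * con P j xf.
  apply: ler_sum => j _; rewrite dotZl.
  have -> : lam j 0 * con P j xf = lam j 0 * (con P j xf - con P j x).
    by rewrite mulrBr compl subr0.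
  rewrite ler_wpM2l// lerBrDl.
  apply: convex_above_tangent; [exact: Pconv|exact: con_differentiable].
rewrite [X in _ <= X -> _](bigD1 i)//=.
have : \sum_(j | j != i) lam j 0 * con P j xf <= 0.
  by apply: sumr_le0 => j _; rewrite mulr_ge0_le0.
rewrite mulrN; lra.
Qed.

(** KKT points paired with their multipliers: unlike the existential conditions
    defining [kkt_points], the conditions on pairs pass to limits.  Multipliers
    are rows here because [rV_compact] is about rows. *)
Definition kkt_pairs : set ('cV[R]_n * 'rV[R]_m) :=
  [set p : 'cV[R]_n * 'rV[R]_m | [/\ polyhedron P p.1,
    (forall i, con P i p.1 <= 0), (forall i, 0 <= p.2 0 i),
    normal_cone (polyhedron P) p.1
      (- grad (obj P) p.1 - \sum_i p.2 0 i *: grad (con P i) p.1) &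
    forall i, p.2 0 i * con P i p.1 = 0]].

Lemma kkt_pairs_fst : fst @` kkt_pairs = kkt_points P.
Proof.
apply/seteqP; split=> [_ [[x lam] /= [Xx x_le lam0 normal compl] <-]|x].
  split => //; exists lam^T; split=> [i||i]; rewrite ?mxE//.
  by under eq_bigr do rewrite mxE.
move=> [Xx x_le [lam [lam0 normal compl]]]; exists (x, lam^T) => //=.
split=> //= [i||i]; rewrite ?mxE//.
by under eq_bigr do rewrite mxE.
Qed.

Lemma kkt_multiplier_bound : standing_assumptions P ->
  exists M : 'I_m -> R, forall p, kkt_pairs p -> forall i, p.2 0 i <= M i.
Proof.
move=> [_ [D hD] _ _ Pconv [Bf hBf] _ [xf [Xxf xf_lt]]].
exists (fun i => n%:R * Bf * D / - con P i xf).
move=> [x lam] /= [Xx x_le lam0 normal compl] i.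
rewrite ler_pdivlMr ?oppr_gt0//.
have := @multiplier_bound x xf lam^T Pconv Xxf.
under eq_bigr do rewrite mxE; move=> bound.
have {bound} := bound _ _ _ _ i; rewrite mxE => h.
apply: le_trans (h _ _ _ _) _ => [j|j||j|]; rewrite ?mxE//; first exact: ltW.
apply: le_trans (ler_norm _) (le_trans (norm_dot_le _ _) _).
rewrite -!mulrA ler_wpM2l// ler_pM//.
  exact: le_trans (norm_le_enorm _) (hBf _ Xx).
exact: le_trans (norm_le_enorm _) (hD _ _ Xxf Xx).
Qed.

(** All conditions but the normal cone one are inequalities between continuous
    functions of the pair.  The gradients are controlled on the polyhedron only,
    so that condition is first weakened at each pair [(x, lam)] to one whose
    gradients are taken at the limit point [x0], with an error
    [C * `|x - x0|] that comes from the Lipschitz bound on gradients and the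
    bound on multipliers.  The weakened condition is continuous in the pair, and
    at [x0] itself the error vanishes. *)
Lemma kkt_pairs_closed : standing_assumptions P -> closed kkt_pairs.
Proof.
move=> SA; have [M hM] := kkt_multiplier_bound SA.
case: SA => _ [D hD] _ [L [Lf Lg]] _ _ _ _.
have fst_cont : continuous (fun p : 'cV[R]_n * 'rV[R]_m => p.1).
  by move=> p; exact: cvg_fst.
have snd_cont : continuous (fun p : 'cV[R]_n * 'rV[R]_m => p.2).
  by move=> p; exact: cvg_snd.
have lam_cont i : continuous (fun p : 'cV[R]_n * 'rV[R]_m => p.2 0 i).
  move=> p; apply: (continuous_comp (f := snd) (g := fun v : 'rV[R]_m => v 0 i)).
    exact: snd_cont.
  exact: coord_continuous.
have constr_cont s : continuous (fun p : 'cV[R]_n * 'rV[R]_m => constr P s p.1).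
  move=> p; apply: (continuous_comp (f := fst) (g := constr P s)).
    exact: fst_cont.
  exact: constr_continuous.
apply/closure_id/seteqP; split; first exact: subset_closure.
move=> [x0 lam0] cl.
have Xx0 : polyhedron P x0.
  move=> j; apply: (closure_le0 (p := (x0, lam0)) (constr_cont (inr j))) cl => p.
  by case=> /(_ j).
split => //= [i|i|y Xy|i].
- apply: (closure_le0 (p := (x0, lam0)) (constr_cont (inl i))) cl => p.
  by case=> _ /(_ i).
- rewrite -oppr_le0.
  apply: (closure_le0 (p := (x0, lam0))
    (psi := fun p : 'cV[R]_n * 'rV[R]_m => - p.2 0 i)) cl => [p|p].
    by apply: cvgN; exact: lam_cont.
  by case=> _ _ /(_ i); rewrite oppr_le0.
- pose C := n%:R * (`|L| * n%:R) * D * (1 + \sum_i M i).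
  pose psi (p : 'cV[R]_n * 'rV[R]_m) := - dot (grad (obj P) x0) (y - p.1)
    - \sum_i p.2 0 i * dot (grad (con P i) x0) (y - p.1) - C * `|p.1 - x0|.
  have psi_le : psi (x0, lam0) <= 0.
    apply: closure_le0 cl; last move=> [x lam] T.
      have ycont : continuous (fun p : 'cV[R]_n * 'rV[R]_m => y - p.1).
        by move=> p; apply: continuousB; [exact: cst_continuous|exact: fst_cont].
      have dcont a : continuous (fun p : 'cV[R]_n * 'rV[R]_m => dot a (y - p.1)).
        move=> p; apply: (continuous_comp (f := fun p => y - p.1) (g := dot a)).
          exact: ycont.
        exact: dot_continuous.
      have c1 : continuous (fun p : 'cV[R]_n * 'rV[R]_m =>
          - dot (grad (obj P) x0) (y - p.1)).
        by move=> p; apply: cvgN; exact: dcont.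
      have c2 : continuous (fun p : 'cV[R]_n * 'rV[R]_m =>
          \sum_i p.2 0 i * dot (grad (con P i) x0) (y - p.1)).
        apply: continuous_big => [|i _ p]; first exact: add_continuous.
        by apply: cvgM; [exact: lam_cont|exact: dcont].
      have c3 : continuous (fun p : 'cV[R]_n * 'rV[R]_m => C * `|p.1 - x0|).
        move=> p; apply: cvgM; first exact: cst_continuous.
        apply: (continuous_comp (f := fun p => p.1 - x0) (g := Num.norm)).
          by apply: continuousB; [exact: fst_cont|exact: cst_continuous].
        exact: norm_continuous.
      by move=> p; apply: cvgB; [apply: cvgB; [exact: c1|exact: c2]|exact: c3].
    have lamM i : lam 0 i <= M i := hM _ T i.
    case: T => /= Xx _ lam_ge0 /(_ y Xy).
    rewrite dotDl !dotNl dot_suml => normal _.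
    pose E := n%:R * (`|L| * n%:R) * D * `|x - x0|.
    have perturb (h : 'cV[R]_n -> R) : lipschitz_grad_on (polyhedron P) L h ->
        - dot (grad h x0) (y - x) <= - dot (grad h x) (y - x) + E.
      move=> Lh; rewrite -lerBlDl opprK.
      have -> : - dot (grad h x0) (y - x) + dot (grad h x) (y - x) =
          dot (grad h x - grad h x0) (y - x) by rewrite dotDl dotNl addrC.
      apply: le_trans (ler_norm _) (le_trans (norm_dot_le _ _) _).
      have -> : E = n%:R * (`|L| * (n%:R * `|x - x0|)) * D by rewrite /E; ring.
      rewrite ler_pM ?mulr_ge0//; last first.
        exact: le_trans (norm_le_enorm _) (hD _ _ Xy Xx).
      rewrite ler_wpM2l//.
      apply: le_trans (norm_le_enorm _) (le_trans (Lh _ _ Xx Xx0) _).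
      apply: le_trans (ler_norm _) _; rewrite normrM ler_wpM2l//.
      by rewrite ger0_norm ?enorm_ge0// enorm_le_norm.
    have E0 : 0 <= E.
      by rewrite /E !mulr_ge0// (le_trans (enorm_ge0 _) (hD _ _ Xy Xx)).
    rewrite /psi /=.
    have -> : C * `|x - x0| = E * (1 + \sum_i M i) by rewrite /C /E; ring.
    have := perturb _ Lf.
    have : - \sum_i lam 0 i * dot (grad (con P i) x0) (y - x) <=
        - \sum_i dot (lam 0 i *: grad (con P i) x) (y - x) + E * \sum_i M i.
      rewrite -!sumrN mulr_sumr -big_split; apply: ler_sum => i _ /=.
      rewrite dotZl -!mulrN.
      apply: le_trans (ler_wpM2l (lam_ge0 i) (perturb _ (Lg i))) _.
      by rewrite mulrDr lerD2l mulrC ler_wpM2l.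
    lra.
  move: psi_le; rewrite /psi /= subrr normr0 mulr0 subr0 dotDl !dotNl dot_suml.
  by under [X in _ -> _ - X <= _]eq_bigr do rewrite dotZl.
- have pcont : continuous (fun p : 'cV[R]_n * 'rV[R]_m => p.2 0 i * con P i p.1).
    by move=> p; apply: cvgM; [exact: lam_cont|exact: (constr_cont (inl i))].
  apply/eqP; rewrite eq_le; apply/andP; split.
    by apply: (closure_le0 (p := (x0, lam0)) pcont) cl => p; case=> _ _ _ _ ->.
  rewrite -oppr_le0.
  apply: (closure_le0 (p := (x0, lam0))
    (psi := fun p : 'cV[R]_n * 'rV[R]_m => - (p.2 0 i * con P i p.1))) cl
    => [p|p].
    by apply: cvgN; exact: pcont.
  by case=> _ _ _ _ ->; rewrite oppr0.
Qed.

Lemma kkt_points_compact : standing_assumptions P -> compact (kkt_points P).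
Proof.
move=> SA; have [M hM] := kkt_multiplier_bound SA.
rewrite -kkt_pairs_fst; apply: continuous_compact.
  by apply: continuous_subspaceT => p; exact: cvg_fst.
have box := @rV_compact R m (fun i => `[0, M i]%classic)
  (fun i => @segment_compact R 0 (M i)).
apply: subclosed_compact (compact_setX (polyhedron_compact SA) box) _.
  exact: kkt_pairs_closed SA.
move=> p Tp; split; first by case: Tp.
by move=> i /=; rewrite in_itv /= hM// andbT; case: Tp.
Qed.

(** By compactness of the set of KKT points it is enough to have constants that
    work for all [xstar] near a given KKT point [x0].  The constants of
    [local_error_bound] at [x0] do, because an index active at [xstar] is active
    at [x0].  A single integer [N] plays both roles,
    [delta = gamma^-1 = N.+1^-1], which turns the covering argument into a
    statement for [N] large. *)
Lemma local_LICQ_EBC :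
  standing_assumptions P -> local_LICQ P -> local_EBC P.
Proof.
move=> SA [zeta [zeta0 licq]].
have /compact_near_coveringP cover := kkt_points_compact SA.
pose EB (N : nat) (xstar : 'cV[R]_n) := forall x, eball xstar N.+1%:R^-1 x ->
  forall (Ig : {set 'I_m}) (IA : {set 'I_l}),
  Ig \subset active_con P xstar -> IA \subset active_lin P xstar ->
  dist x (active_face P Ig IA) ^+ 2 <= N.+1%:R * sq_residual P Ig IA x.
have [x0 Kx0|N _ /(_ N (leqnn N)) hN] := cover _ \oo EB _.
  have x0_le s : constr P s x0 <= 0.
    by case: Kx0 => Xx0 g_le _; case: s => [i|j]; [exact: g_le|exact: Xx0].
  have inj := sigma_min_injective zeta0 (licq _ Kx0).
  have [gamma] := local_error_bound (con_convex SA) x0_le inj.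
  move=> /near_norm_ball[r r0 bound].
  have r2 : 0 < r / 2 by rewrite divr_gt0.
  have xstar_near : \forall xstar \near x0, `|xstar - x0| < r / 2.
    apply/nbhs_normP; exists (r / 2) => //= y.
    by rewrite /ball_ /= distrC.
  near=> xstar N => /= x xx Ig IA IgS IAS.
  have inactive : forall s, constr P s x0 < 0 -> constr P s xstar < 0.
    by near: xstar; exact: inactive_near.
  have active s : constr P s xstar = 0 -> constr P s x0 = 0.
    have := x0_le s; rewrite le_eqVlt => /orP[/eqP//|/inactive + s0].
    by rewrite s0 ltxx.
  have IgS0 : Ig \subset active_con P x0.
    apply: fintype.subset_trans IgS _; apply/fintype.subsetP => i.
    by rewrite !inE => /eqP/(active (inl i))/eqP.
  have IAS0 : IA \subset active_lin P x0.
    apply: fintype.subset_trans IAS _; apply/fintype.subsetP => j.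
    by rewrite !inE => /eqP/(active (inr j))/eqP.
  apply: le_trans (bound x _ _ _ IgS0 IAS0) _.
    have -> : x - x0 = (x - xstar) + (xstar - x0) by rewrite addrA subrK.
    rewrite [r]splitr (le_lt_trans (ler_normD _ _))// ltrD//.
    apply: le_lt_trans (norm_le_enorm _) _; apply: le_lt_trans xx _.
    by near: N; exact: (near_infty_natSinv_lt (PosNum r2)).
  rewrite ler_wpM2r//; last first.
    apply: le_trans (_ : N%:R <= _); last by rewrite ler_nat.
    by near: N; exact: nbhs_infty_ger.
  rewrite sq_residual_violation sumr_ge0// => k _; exact: sqr_ge0.
exists N.+1%:R^-1, N.+1%:R, 1; split; rewrite ?invr_gt0// ?lexx ?ler1n//.
move=> xstar x Kx xx Ig IA IgS IAS.
by rewrite mulr1 powR_mulrn ?dist_ge0//; exact: (hN _ Kx).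
Unshelve. all: by end_near. Qed.

End MainImplication.

(** * An instance with the error bound but without LICQ *)

Section Converse.
Variable R : realType.

(** The rows [x <= 0] and [- x <= 0], which describe the set [{0}] in dimension
    one. *)
Definition opposite_rows : 'M[R]_(2, 1) := \matrix_(j, k) (-1) ^+ j.

(** Zero objective and the constant constraint [-1 <= 0], so that only the two
    opposite rows can be active. *)
Definition point_problem : problem R 1 1 2 :=
  Problem opposite_rows 0
    (fun x : 'cV[R]_1 => differentiable_cst (0 : R) x)
    (fun (_ : 'I_1) (x : 'cV[R]_1) => differentiable_cst (-1 : R) x).

Lemma point_lin_res x j : lin_res point_problem x j = (-1) ^+ j * x 0 0.
Proof. by rewrite /lin_res !mxE big_ord1 mxE subr0. Qed.

Lemma point_polyhedron : polyhedron point_problem = [set 0].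
Proof.
apply/seteqP; split=> [x Xx|_ -> j]; last by rewrite point_lin_res mxE mulr0.
apply/colP => i; rewrite (ord1 i) mxE; apply/eqP; rewrite eq_le.
have := Xx ord0; have := Xx ord_max; rewrite !point_lin_res expr0 expr1 /=.
by rewrite mul1r mulN1r oppr_le0 => -> ->.
Qed.

Lemma point_standing : standing_assumptions point_problem.
Proof.
have X0 x : polyhedron point_problem x -> x = 0 by rewrite point_polyhedron.
have lip h : lipschitz_grad_on (polyhedron point_problem) 0 h.
  move=> x y /X0-> /X0->; rewrite !subrr mul0r /enorm big1 ?sqrtr0// => k _.
  by rewrite mxE expr0n.
split.
- by rewrite point_polyhedron; exact: compact_set1.
- by exists (enorm (0 : 'cV[R]_1)) => x y /X0-> /X0->; rewrite subrr.
- by exists 0.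
- by exists 0; split=> [|i]; exact: lip.
- move=> i t x y _ _; rewrite convRE /= -mulrDl.
  by rewrite addrC subrK mul1r.
- by exists (enorm (grad (obj point_problem) 0)) => x /X0->.
- by exists (Num.max (enorm (con_vec point_problem 0))
    (spectral_norm (grad_con point_problem 0))) => x /X0->.
- by exists 0; rewrite point_polyhedron; split=> // i /=; rewrite ltrN10.
Qed.

Lemma point_kkt : kkt_points point_problem 0.
Proof.
split; [by rewrite point_polyhedron| by move=> i /=; rewrite lerN10|].
exists 0; split=> [i|y|i]; rewrite ?mxE ?mul0r//.
rewrite point_polyhedron => ->.
by rewrite subrr -(scale0r 0) dotZr mul0r.
Qed.

(** The face is always [{0}], so the distance is [`|x|], and one of the two
    opposite rows is violated by exactly [`|x|]. *)
Lemma point_EBC : local_EBC point_problem.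
Proof.
exists 1, 1, 1; split; rewrite ?lexx ?ler1n//.
move=> xstar x [Xxstar gxstar _] _ Ig IA IgS IAS.
have face0 := active_face_center Xxstar gxstar IgS IAS.
move: Xxstar face0; rewrite point_polyhedron => -> face0.
have res0 : 0 <= sq_residual point_problem Ig IA x.
  by rewrite sq_residual_violation sumr_ge0// => k _; exact: sqr_ge0.
rewrite mulr1 powR_mulrn ?dist_ge0// mul1r -(sqr_sqrtr res0).
rewrite lerXn2r ?nnegrE ?dist_ge0 ?sqrtr_ge0//.
apply: le_trans (dist_le x face0) _; rewrite subr0 /enorm big_ord1 sqrtr_sqr.
have [x0|x0] := leP 0 (x 0 0).
  have := violation_le_residual point_problem Ig IA (inr ord0) x.
  rewrite /violation /= point_lin_res mul1r ger0_norm//.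
  by case: ifP => // _; rewrite max_l.
have := violation_le_residual point_problem Ig IA (inr ord_max) x.
rewrite /violation /= point_lin_res expr1 mulN1r normrN ltr0_norm//.
by case: ifP => // _; rewrite max_l// oppr_ge0 ltW.
Qed.

(** LICQ makes the Gram matrix of the active gradients invertible; its size is
    at least two, while its rank is at most the dimension one of the space. *)
Lemma point_not_LICQ : ~ local_LICQ point_problem.
Proof.
move=> [zeta [zeta0 licq]].
have := gram_unitmx (sigma_min_injective zeta0 (licq _ point_kkt)).
move=> /mxrank_unit rk.
have : (#|active_con point_problem 0| + #|active_lin point_problem 0| <= 1)%N.
  by rewrite -{1}rk (leq_trans (mxrankM_maxr _ _))// rank_leq_row.
suff -> : active_lin point_problem 0 = [set: 'I_2]%SET.
  by rewrite cardsT card_ord addn2.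
by apply/setP => j; rewrite !inE point_lin_res mxE mulr0 eqxx.
Qed.

End Converse.

Theorem proposition3p4 (R : realType) :
  (forall (n m l : nat) (P : problem R n m l),
     standing_assumptions P -> local_LICQ P -> local_EBC P)
  /\
  (exists (n m l : nat) (P : problem R n m l),
     [/\ (0 < n)%N, (0 < m)%N & (0 < l)%N] /\
     [/\ standing_assumptions P, local_EBC P & ~ local_LICQ P]).
Proof.
split=> [n m l P|]; first exact: local_LICQ_EBC.
exists 1, 1, 2, (point_problem R); split=> //; split.
- exact: point_standing.
- exact: point_EBC.
- exact: point_not_LICQ.
Qed.
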